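(* Fix $H$ and $\Lambda$. There are positive constants $c_1,c_2,c_3,c_4$ (depending only on $H$ and $\Lambda$) such that the following holds. Let $G$ be a bipartite graph on $N$ vertices with bipartition classes $\mathcal{E}$ and $\mathcal{O}$, where $|\mathcal{O}|\geq |\mathcal{E}|$. Let $d>0$ be an arbitrary positive parameter and set $$h(G,d) = \frac{1}{d} + \frac{|\{v \in \mathcal{E}: d(v) < d\}|}{N} + \frac{|\mathcal{O}|-|\mathcal{E}|}{N} + \frac{1}{dN}\sum_{v \in \mathcal{O}} (d(v)-d)\mathbf{1}_{\{d(v)\geq d\}},$$ where $d(v)$ is the degree of the vertex $v$ in $G$. Let $f$ denote a random element of ${\rm Hom}(G,H)$ chosen according to $p_\Lambda$. Then for every $\varepsilon \geq c_1\sqrt{h(G,d)}$ and every $k \in V(H)$, $$p_\Lambda\left(s(k,f) \in I_k(\varepsilon)\right) \leq c_2\varepsilon^{-1}2^{-c_3\varepsilon^2N},$$ and for every $k \in V(H)$, $$\bar{p}_\Lambda(k) \in \left[a_\Lambda^-(k) - c_4\zeta,\; a_\Lambda^+(k) + c_4\zeta\right],\qquad \text{where } \zeta = \max \left\{\sqrt{h(G,d)}, \sqrt{\frac{\log N}{N}}\right\}.$$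
   Context: $G=(V(G),E(G))$ is a simple, loopless, finite graph; $H$ is a finite graph without multiple edges but perhaps with loops, having at least one edge (possibly a loop); $\Lambda=\{\lambda_i : i\in V(H)\}$ is a set of positive real weights indexed by the vertices of $H$. Logarithms are to base 2. An $H$-colouring of $G$ is a function $f:V(G)\to V(H)$ such that $uv\in E(G)$ implies $f(u)f(v)\in E(H)$; ${\rm Hom}(G,H)$ is the set of these. Put $w_\Lambda(f)=\prod_{v\in V(G)}\lambda_{f(v)}$, $Z_\Lambda(G,H)=\sum_{f\in{\rm Hom}(G,H)}w_\Lambda(f)$, and let $p_\Lambda$ be the probability distribution on ${\rm Hom}(G,H)$ with $p_\Lambda(f)=w_\Lambda(f)/Z_\Lambda(G,H)$. For $f \in {\rm Hom}(G,H)$ and $k\in V(H)$ let $s(k,f)=|f^{-1}(k)|/|V(G)|$ and let $\bar p_\Lambda(k)=\frac{1}{|V(G)|}\sum_{v\in V(G)}p_\Lambda(f(v)=k)$, the expectation of $s(k,f)$ under $p_\Lambda$. For $A,B\subseteq V(H)$ write $A\sim B$ if $uv\in E(H)$ for all $u\in A$, $v\in B$. Let $w_\Lambda(A)=\sum_{i\in A}\lambda_i$, $\eta_\Lambda(H)=\max\{w_\Lambda(A)w_\Lambda(B):A\sim B\}$, and $\mathcal{M}_\Lambda(H)=\{(A,B): A,B\subseteq V(H),\ A\sim B,\ w_\Lambda(A)w_\Lambda(B)=\eta_\Lambda(H)\}$. For $k\in V(H)$ let $$a_\Lambda^+(k)=\frac{\max\{w_\Lambda(A)\lambda_k\mathbf{1}_{\{k\in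 B\}}+w_\Lambda(B)\lambda_k\mathbf{1}_{\{k\in A\}}:(A,B)\in\mathcal{M}_\Lambda(H)\}}{2\eta_\Lambda(H)},$$ and let $a_\Lambda^-(k)$ be defined in the same way with $\max$ replaced by $\min$. For $\varepsilon>0$ let $I_k(\varepsilon)=[0,a_\Lambda^-(k)-\varepsilon)\cup(a_\Lambda^+(k)+\varepsilon,1]$ (an interval whose endpoints are out of order is empty). *)

(* Defs.v *)
From HB Require Import structures.
From mathcomp Require Import all_boot all_order all_algebra.
From mathcomp Require Import reals exp.

Set Implicit Arguments.
Unset Strict Implicit.
Unset Printing Implicit Defensive.

Import Order.TTheory GRing.Theory Num.Theory.
Local Open Scope ring_scope.

Definition log2 (R : realType) (x : R) : R := ln x / ln 2.

(* A graph without multiple edges is a symmetric relation on a finType; it is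
   loopless when the relation is moreover irreflexive. *)
Definition bipartition (VG : finType) (eG : rel VG) (E O : {set VG}) : Prop :=
  [/\ E :|: O = setT, [disjoint E & O],
      {in E &, forall u v, ~~ eG u v} & {in O &, forall u v, ~~ eG u v}].

Definition degree (VG : finType) (eG : rel VG) (v : VG) : nat :=
  #|[set u | eG v u]|.

Definition hfun (R : realType) (VG : finType) (eG : rel VG) (E O : {set VG})
    (d : R) : R :=
  let N := #|VG|%:R in
  d^-1
  + #|[set v in E | (degree eG v)%:R < d]|%:R / N
  + (#|O|%:R - #|E|%:R) / N
  + (d * N)^-1
    * \sum_(v in O | d <= (degree eG v)%:R) ((degree eG v)%:R - d).

Definition HomG (VG : finType) (eG : rel VG) (VH : finType) (eH : rel VH) :
    {set {ffun VG -> VH}} :=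
  [set f : {ffun VG -> VH} |
    [forall u, [forall v, eG u v ==> eH (f u) (f v)]]].

Definition weight (R : realType) (VG VH : finType) (lam : VH -> R)
    (f : {ffun VG -> VH}) : R :=
  \prod_(v : VG) lam (f v).

Definition Zfun (R : realType) (VG : finType) (eG : rel VG) (VH : finType)
    (eH : rel VH) (lam : VH -> R) : R :=
  \sum_(f in HomG eG eH) weight lam f.

Definition prob (R : realType) (VG : finType) (eG : rel VG) (VH : finType)
    (eH : rel VH) (lam : VH -> R) (P : pred {ffun VG -> VH}) : R :=
  \sum_(f in HomG eG eH | P f) weight lam f / Zfun eG eH lam.

Definition share (R : realType) (VG VH : finType) (k : VH)
    (f : {ffun VG -> VH}) : R :=
  #|[set v | f v == k]|%:R / #|VG|%:R.

Definition pbar (R : realType) (VG : finType) (eG : rel VG) (VH : finType)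
    (eH : rel VH) (lam : VH -> R) (k : VH) : R :=
  #|VG|%:R^-1 * \sum_(v : VG) prob eG eH lam (fun f => f v == k).

Definition joined (VH : finType) (eH : rel VH) (A B : {set VH}) : bool :=
  [forall u in A, [forall v in B, eH u v]].

Definition wset (R : realType) (VH : finType) (lam : VH -> R) (A : {set VH}) :
    R :=
  \sum_(i in A) lam i.

(* The default value 0 is harmless: for positive weights all the products are
   nonnegative, and the index set contains (set0, set0). *)
Definition eta (R : realType) (VH : finType) (eH : rel VH) (lam : VH -> R) : R :=
  \big[Num.max/0]_(AB : {set VH} * {set VH} | joined eH AB.1 AB.2)
     (wset lam AB.1 * wset lam AB.2).

Definition Mset (R : realType) (VH : finType) (eH : rel VH) (lam : VH -> R) :
    {set {set VH} * {set VH}} :=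
  [set AB | joined eH AB.1 AB.2
            && (wset lam AB.1 * wset lam AB.2 == eta eH lam)].

Definition occ (R : realType) (VH : finType) (lam : VH -> R) (k : VH)
    (AB : {set VH} * {set VH}) : R :=
  wset lam AB.1 * lam k * (k \in AB.2)%:R
  + wset lam AB.2 * lam k * (k \in AB.1)%:R.

Definition occ_max (R : realType) (VH : finType) (eH : rel VH) (lam : VH -> R)
    (k : VH) : R :=
  \big[Num.max/0]_(AB in Mset eH lam) occ lam k AB.

(* Mset is nonempty, so taking the maximum as the default value leaves the
   minimum unaffected. *)
Definition occ_min (R : realType) (VH : finType) (eH : rel VH) (lam : VH -> R)
    (k : VH) : R :=
  \big[Num.min/occ_max eH lam k]_(AB in Mset eH lam) occ lam k AB.

Definition aplus (R : realType) (VH : finType) (eH : rel VH) (lam : VH -> R)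
    (k : VH) : R :=
  occ_max eH lam k / (2 * eta eH lam).

Definition aminus (R : realType) (VH : finType) (eH : rel VH) (lam : VH -> R)
    (k : VH) : R :=
  occ_min eH lam k / (2 * eta eH lam).

Definition Iset (R : realType) (VH : finType) (eH : rel VH) (lam : VH -> R)
    (k : VH) (eps : R) : pred R :=
  [predU `[0, aminus eH lam k - eps[ & `]aplus eH lam k + eps, 1]].

(* Main.v *)
Require Import Defs.
From mathcomp Require Import all_boot all_order all_algebra.
From mathcomp Require Import reals sequences exp.
From mathcomp Require Import ring lra.

(** Multiply the weight of the colour [k] by [expR t]. The ratio of the new to the
    old partition function is the Laplace transform of [X], the number of vertices
    coloured [k], so estimates of partition functions that hold uniformly over
    weights control both the tails and the mean of [X].

    The partition function lies between [eta `^ (N / 2)] ([Zfun_ge]) and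
    [eta `^ (N / 2) * expR (c * N * h)] ([Zfun_le]). The lower bound colours one
    side from [A] and the other from [B] for an optimal pair. For the upper bound,
    colour [E] first; then each [v] in [O] contributes a factor that depends only on
    the colours of its neighbours. If all vertices of [E] have degree at least [d],
    Finner's inequality ([finner_inequality]), the functional counterpart of
    Shearer's entropy lemma, bounds the sum of the product of these factors by the
    product of their [L^d] norms. The [d]-th power of such a norm enumerates the
    colourings of a complete bipartite graph with parts of size [degree v] and [d],
    and grouping them by the set of colours on the first part bounds it by about
    [2 ^+ #|VH| * eta `^ d] ([star_bound]). The [d]-th root makes the first factor
    cost [1 / d] per vertex, and irregularities of the degrees cost the remaining
    terms of [h]; low degrees in [O] are controlled by double counting the edges
    ([sum_dist_degree]).

    By first-order perturbation, [ln eta / 2] grows under the tilt at most by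
    [t * a + C * t ^+ 2], where [a] is [aplus] for positive and [aminus] for
    negative [t] ([eta_tilt_le]). Hence the Laplace transform of [X] is at most
    [expR (N * (t * a + C * t ^+ 2 + c * h))] ([mgf_bound]). Chernoff's bound with
    [t] of order [eps] gives the tails, the error [c * h] being negligible as soon as
    [eps] is a large multiple of [Num.sqrt h]; Jensen's inequality with
    [t = Num.sqrt h] gives the mean. *)

Import Order.TTheory GRing.Theory Num.Theory.
Local Open Scope ring_scope.

Set Implicit Arguments.
Unset Strict Implicit.
Unset Printing Implicit Defensive.

(** * Hölder's inequality over a discrete measure *)

Lemma powR_prod_seq (R : realType) (J : finType) (P : pred J) (F : J -> R) (r : R) :
  (forall j, P j -> 0 <= F j) ->
  (\prod_(j | P j) F j) `^ r = \prod_(j | P j) F j `^ r.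
Proof.
move=> F0; suff [] : 0 <= \prod_(j | P j) F j /\
  (\prod_(j | P j) F j) `^ r = \prod_(j | P j) F j `^ r by [].
elim/big_rec2: _ => [|j y1 y2 Pj [y0 ih]]; first by rewrite powR1 ler01.
split; first by rewrite mulr_ge0 ?F0.
by rewrite powRM ?F0// ih.
Qed.

(** With every [c j] normalised to have integral 1 and bounded by 1, lowering the
    exponent from [d^-1] to [#|T|^-1] only increases the product, and the geometric
    mean of the [c j i] is then at most their arithmetic mean, whose integral is 1. *)
Lemma holder_normalised (R : realType) (I J : finType) (P : pred I) (T : {set J})
    (mu : I -> R) (c : J -> I -> R) (d : R) :
  0 < d -> d <= #|T|%:R ->
  (forall i, P i -> 0 <= mu i) ->
  (forall j i, P i -> j \in T -> 0 <= c j i <= 1) ->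
  (forall j, j \in T -> \sum_(i | P i) mu i * c j i = 1) ->
  \sum_(i | P i) mu i * \prod_(j in T) c j i `^ d^-1 <= 1.
Proof.
move=> d0 dT mu0 c01 sum1.
have T0 : (0 : R) < #|T|%:R by exact: lt_le_trans d0 dT.
have Tn0 : (#|T| != 0)%N by move: T0; rewrite ltr0n lt0n.
apply: (@le_trans _ _ (\sum_(i | P i) mu i * (\sum_(j in T) c j i / #|T|%:R))).
  apply: ler_sum => i Pi; apply: ler_wpM2l; first exact: mu0.
  have cP j : j \in T -> 0 <= c j i by move=> jT; case/andP: (c01 j i Pi jT).
  apply: (@le_trans _ _ ((\prod_(j in T) c j i) `^ (#|T|%:R)^-1)).
    rewrite powR_prod_seq //; apply: ler_prod => j jT.
    rewrite powR_ge0 /=.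
    have /andP[c0 c1] := c01 j i Pi jT.
    have [->|cn0] := eqVneq (c j i) 0.
      by rewrite !powR0 // invr_neq0 // gt_eqF.
    apply: ger_powR; first by rewrite lt0r cn0 c0 c1.
    by rewrite lef_pV2 // posrE.
  have AGM := (leif_AGM cP).1.
  have := @ge0_ler_powR _ (#|T|%:R^-1 : R) _ _ _ _ _ AGM.
  rewrite invr_ge0 ler0n => /(_ isT).
  have p0 : 0 <= \prod_(j in T) c j i by exact: prodr_ge0.
  have s0 : 0 <= \sum_(j in T) c j i / #|T|%:R.
    by apply: sumr_ge0 => j jT; rewrite divr_ge0 // cP.
  rewrite -mulr_suml in s0 *.
  rewrite !nnegrE p0 exprn_ge0 // => /(_ isT isT) /le_trans; apply.
  rewrite -powR_mulrn // -powRrM divff ?powRr1 //.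
  by rewrite pnatr_eq0.
under eq_bigr do rewrite mulr_sumr.
rewrite exchange_big /=.
under eq_bigr => j jT.
  under eq_bigr do rewrite mulrA.
  rewrite -mulr_suml sum1 // mul1r.
  over.
by rewrite sumr_const -[X in X <= _]mulr_natr mulVf ?pnatr_eq0.
Qed.

(** The step that integrates out one coordinate in Finner's inequality. Since the
    measure has atoms of mass at least 1, normalised functions are bounded by 1. So
    when fewer than [d] factors are available, the product is simply bounded by 1
    at the price of the total mass; otherwise [holder_normalised] applies. *)
Lemma holder_cover (R : realType) (I J : finType) (P : pred I) (T : {set J})
    (mu : I -> R) (b : J -> I -> R) (d : R) :
  0 < d ->
  (forall i, P i -> 1 <= mu i) ->
  (forall j i, 0 <= b j i) ->
  \sum_(i | P i) mu i * \prod_(j in T) b j i `^ d^-1 <=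
  (\sum_(i | P i) mu i) ^+ (#|T|%:R < d)%R
    * \prod_(j in T) (\sum_(i | P i) mu i * b j i) `^ d^-1.
Proof.
move=> d0 mu1 b0.
have mu0 i : P i -> 0 <= mu i by move=> /mu1; apply: le_trans.
have dV0 : d^-1 != 0 by rewrite invr_neq0 // gt_eqF.
set B := fun j => \sum_(i | P i) mu i * b j i.
have B0 j : 0 <= B j by apply: sumr_ge0 => i Pi; rewrite mulr_ge0 ?mu0.
have W0 : 0 <= \sum_(i | P i) mu i by exact: sumr_ge0.
(* A factor with vanishing integral kills both sides and cannot be normalised. *)
have [/existsP[j /andP[jT /eqP Bj]]|] := boolP [exists j in T, B j == 0].
  apply: (@le_trans _ _ 0); last first.
    by rewrite mulr_ge0 ?exprn_ge0 // prodr_ge0 // => *; rewrite powR_ge0.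
  apply: sumr_le0 => i Pi; rewrite (bigD1 j) //=.
  suff -> : b j i = 0 by rewrite powR0 // mul0r mulr0.
  have : mu i * b j i = 0.
    move: Bj; rewrite /B => /eqP; rewrite psumr_eq0; last first.
      by move=> k Pk; rewrite mulr_ge0 ?mu0.
    by move=> /allP /(_ i (mem_index_enum _)) /implyP/(_ Pi)/eqP.
  move/eqP; rewrite mulf_eq0 => /orP[/eqP m0|/eqP//].
  by have := mu1 i Pi; rewrite m0 ler10.
rewrite negb_exists => /forallP Bn0'.
have Bn0 j : j \in T -> B j != 0 by move=> jT; have := Bn0' j; rewrite jT.
have Bgt0 j : j \in T -> 0 < B j by move=> jT; rewrite lt0r Bn0 // B0.
set c := fun j i => b j i / B j.
have c01 j i : P i -> j \in T -> 0 <= c j i <= 1.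
  move=> Pi jT; rewrite divr_ge0 //= ler_pdivrMr ?Bgt0 // mul1r.
  rewrite /B (bigD1 i) //=; apply: ler_wpDr.
    by apply: sumr_ge0 => k /andP[Pk _]; rewrite mulr_ge0 ?mu0.
  by rewrite ler_peMl // mu1.
have sum1 j : j \in T -> \sum_(i | P i) mu i * c j i = 1.
  move=> jT; rewrite /c; under eq_bigr do rewrite mulrA.
  by rewrite -mulr_suml divff // Bn0.
have -> : \sum_(i | P i) mu i * \prod_(j in T) b j i `^ d^-1 =
    (\sum_(i | P i) mu i * \prod_(j in T) c j i `^ d^-1)
    * \prod_(j in T) B j `^ d^-1.
  rewrite mulr_suml; apply: eq_bigr => i Pi; rewrite -mulrA; congr (_ * _).
  rewrite -big_split /=; apply: eq_bigr => j jT.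
  by rewrite -powRM ?divr_ge0 // divfK // Bn0.
apply: ler_wpM2r; first by rewrite prodr_ge0 // => *; rewrite powR_ge0.
case: ltP => Td.
  rewrite expr1; apply: ler_sum => i Pi; apply: ler_piMr; first exact: mu0.
  apply: prodr_ile1 => j jT; rewrite powR_ge0 /=.
  have /andP[c0 c1] := c01 j i Pi jT.
  have := @ge0_ler_powR _ d^-1 _ (c j i) 1.
  by rewrite powR1 invr_ge0 (ltW d0) !nnegrE c0 ler01; apply.
by rewrite expr0; exact: holder_normalised.
Qed.

(** * Finner's inequality on a product space *)

Section Marginal.
Context {R : realType} {V C : finType}.
Variable mu : C -> R.
Implicit Types (S T D : {set V}) (f g h : {ffun V -> C}) (F : {ffun V -> C} -> R).

Definition eq_off S f g := [forall v, (v \notin S) ==> (g v == f v)].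

(** [marginal S F f] integrates out the coordinates in [S], the others staying as in
    [f]; keeping it a function of the whole colouring [f] avoids changing types
    when coordinates are removed one by one. *)
Definition marginal S F f : R :=
  \sum_(g | eq_off S f g) (\prod_(v in S) mu (g v)) * F g.

Definition depends_on D F := forall f g, {in D, f =1 g} -> F f = F g.

Lemma eq_offP S f g : reflect (forall v, v \notin S -> g v = f v) (eq_off S f g).
Proof.
apply: (iffP forallP) => [h v vS|h v]; last by apply/implyP => /h/eqP.
by have := h v; rewrite vS => /eqP.
Qed.

Lemma marginal_prod S (phi : V -> C -> R) f :
  marginal S (fun g => \prod_(v in S) phi v (g v)) f =
  \prod_(v in S) \sum_x mu x * phi v x.
Proof.
rewrite /marginal.
transitivity (\prod_v \sum_(x | (v \in S) || (x == f v))
    (if v \in S then mu x * phi v x else 1)); last first.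
  rewrite (bigID (mem S)) /= [X in _ * X]big1 ?mulr1; last first.
    move=> v vS; rewrite (big_pred1 (f v)) ?(negbTE vS) // => x.
  by apply: eq_bigr => v vS; rewrite vS.
rewrite bigA_distr_big_dep; apply: eq_big => [g|g /eq_offP gf].
  apply/eq_offP/familyP => [h v|h v vS]; last first.
    by have /orP[/(negP vS)|/eqP] : (v \in S) || (g v == f v) := h v.
  suff: (v \in S) || (g v == f v) by [].
  by case: (boolP (v \in S)) => //= /h ->.
rewrite -big_split /= big_mkcond /=; apply: eq_bigr => v _.
by case: ifP.
Qed.

(** Fubini: a colouring that agrees with [f] off [S :|: T] is determined by its
    part on [S] and its part on [T]. *)
Lemma marginal_setU S T F f : [disjoint S & T] ->
  marginal (S :|: T) F f = marginal S (marginal T F) f.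
Proof.
move=> dST; rewrite /marginal.
pose p g := [ffun v => if v \in S then g v else f v] : {ffun V -> C}.
rewrite (partition_big p (eq_off S f)) /=; last first.
  by move=> g _; apply/eq_offP => v vS; rewrite ffunE (negbTE vS).
apply: eq_bigr => h /eq_offP hf; rewrite mulr_sumr; apply: eq_big => g.
  apply/andP/eq_offP => [[/eq_offP gf /eqP <-] v vT|gh].
    rewrite ffunE; case: ifP => // vS; apply: gf.
    by rewrite inE negb_or vS.
  split.
    apply/eq_offP => v; rewrite inE negb_or => /andP[vS vT].
    by rewrite gh // hf.
  apply/eqP/ffunP => v; rewrite ffunE; case: ifPn => vS; last by rewrite hf.
  by apply: gh; rewrite (disjointFr dST vS).
move=> /andP[_ /eqP <-]; rewrite (eq_bigl [predU S & T]); last by move=> v; rewrite !inE.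
rewrite bigU //= mulrA; congr (_ * _ * _).
by apply: eq_bigr => v vS; rewrite ffunE vS.
Qed.

Lemma marginal_indep S D F : depends_on D F -> depends_on D (marginal S F).
Proof.
move=> FD f g fg.
pose m k h := [ffun v => if v \in S then h v else k v] : {ffun V -> C}.
have mS k h : {in S, m k h =1 h} by move=> v vS; rewrite ffunE vS.
have mnS k h v : v \notin S -> m k h v = k v by move=> vS; rewrite ffunE (negbTE vS).
rewrite /marginal (reindex_onto (m f) (m g)) /=; last first.
  move=> h /eq_offP hf; apply/ffunP => v.
  by have [vS|vS] := boolP (v \in S); [rewrite !mS | rewrite mnS // hf].
apply: eq_big => [h|h].
  apply/andP/eq_offP => [[_ /eqP <-] v vS|hg]; first by rewrite mnS.
  split; first by apply/eq_offP => v vS; rewrite mnS.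
  apply/eqP/ffunP => v.
  by have [vS|vS] := boolP (v \in S); [rewrite !mS | rewrite mnS // hg].
move=> /andP[_ /eqP mh]; congr (_ * _).
  by apply: eq_bigr => v vS; rewrite mS.
apply: FD => v vD; have [vS|vS] := boolP (v \in S); first by rewrite mS.
by rewrite mnS // -[in RHS]mh mnS // fg.
Qed.

Lemma marginal_ge0 S F f : (forall x, 0 <= mu x) -> (forall g, 0 <= F g) ->
  0 <= marginal S F f.
Proof.
by move=> mu0 F0; apply: sumr_ge0 => g _; rewrite mulr_ge0 // prodr_ge0.
Qed.

Lemma le_marginal S F K f : (forall x, 0 <= mu x) -> (forall g, F g <= K g) ->
  marginal S F f <= marginal S K f.
Proof.
by move=> mu0 FK; apply: ler_sum => g _; apply: ler_wpM2l; rewrite ?prodr_ge0.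
Qed.

Lemma marginal0 F f : marginal set0 F f = F f.
Proof.
rewrite /marginal (big_pred1 f); first by rewrite big_set0 mul1r.
move=> g; apply/eq_offP/eqP => [gf|-> //]; apply/ffunP => v; apply: gf.
by rewrite inE.
Qed.

Lemma depends_on_eq_off D u F : u \notin D -> depends_on D F ->
  forall f g, eq_off [set u] f g -> F g = F f.
Proof.
move=> uD FD f g /eq_offP gf; apply: FD => v vD; apply: gf.
by rewrite inE; apply: contraNneq uD => <-.
Qed.

(** Finner's inequality, the functional form of Shearer's entropy lemma: if every
    coordinate of [S] lies in at least [d] of the sets [Nb j], the integral of the
    product is at most the product of the [L^d] norms, with no loss. A coordinate
    covered fewer than [d] times costs one factor of the total mass. The coordinates
    are integrated one at a time: the factors that ignore the coordinate [u] come out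
    of the integral, and [holder_cover] handles the others. *)
Lemma finner_inequality (J : finType) (O : {set J}) (Nb : J -> {set V})
    (F : J -> {ffun V -> C} -> R) (d : R) S f :
  0 < d -> (forall x, 1 <= mu x) ->
  (forall j g, 0 <= F j g) -> (forall j, j \in O -> depends_on (Nb j) (F j)) ->
  marginal S (fun g => \prod_(j in O) F j g `^ d^-1) f <=
  (\sum_x mu x) ^+ #|[set u in S | (#|[set j in O | u \in Nb j]|%:R < d)%R]|
    * \prod_(j in O) marginal (S :&: Nb j) (F j) f `^ d^-1.
Proof.
move=> d0 mu1 F0 FN.
have mu0 x : 0 <= mu x by exact: le_trans (mu1 x).
have W0 : 0 <= \sum_x mu x by exact: sumr_ge0.
move: {2}#|S| (erefl #|S|) => n; elim: n S f => [|n IH] S f.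
  move=> /eqP; rewrite cards_eq0 => /eqP ->.
  rewrite marginal0 ?cards0 (_ : [set u in set0 | _] = set0); last first.
    by apply/setP => u; rewrite !inE.
  rewrite cards0 expr0 mul1r; apply: ler_prod => j jO.
  by rewrite powR_ge0 /= set0I marginal0.
move=> cS; have /card_gt0P[u uS] : (0 < #|S|)%N by rewrite cS.
have {}cS : #|S :\ u| = n by move: cS; rewrite (cardsD1 u) uS => -[].
set S' := S :\ u in cS *.
have SE : S = [set u] :|: S' by rewrite setD1K.
have dS : [disjoint [set u] & S'].
  by rewrite disjoints1 !inE eqxx.
rewrite {1}SE (marginal_setU _ _ dS).
set G := fun j => marginal (S' :&: Nb j) (F j).
have G0 j g : 0 <= G j g by exact: marginal_ge0.
have GN j : j \in O -> depends_on (Nb j) (G j).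
  by move=> jO; apply: marginal_indep; exact: FN.
set w := \sum_x mu x.
set bad := fun A : {set V} => [set u in A | (#|[set j in O | u \in Nb j]|%:R < d)%R].
have badE : #|bad S| = ((#|[set j in O | u \in Nb j]|%:R < d)%R + #|bad S'|)%N.
  rewrite (cardsD1 u) !inE uS /=; congr (_ + _)%N; apply: eq_card => v.
  by rewrite !inE; case: (v == u).
apply: (@le_trans _ _ (marginal [set u] (fun g => w ^+ #|bad S'| *
    \prod_(j in O) G j g `^ d^-1) f)).
  by apply: le_marginal => // g; exact: IH.
rewrite (bigID (fun j => u \in Nb j)) /=.
set T := [set j in O | u \in Nb j] in badE *.
have -> : marginal [set u] (fun g => w ^+ #|bad S'| *
    \prod_(j in O) G j g `^ d^-1) f =
   w ^+ #|bad S'| * \prod_(j in O | u \notin Nb j) G j f `^ d^-1 *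
     \sum_(g | eq_off [set u] f g) mu (g u) * \prod_(j in T) G j g `^ d^-1.
  rewrite mulr_sumr; apply: eq_bigr => g fg.
  rewrite big_set1 mulrCA -[RHS]mulrA; congr (_ * _).
  rewrite mulrCA; congr (_ * _); rewrite (bigID (fun j => u \in Nb j)) /= mulrC.
  congr (_ * _); last by apply: eq_bigl => j; rewrite inE.
  apply: eq_bigr => j /andP[jO uj]; congr (_ `^ _).
  exact: (depends_on_eq_off uj (GN j jO) fg).
have := @holder_cover R _ _ (eq_off [set u] f) T (fun g => mu (g u)) G d d0
   (fun g _ => mu1 (g u)) G0.
have -> : \sum_(g | eq_off [set u] f g) mu (g u) = w.
  have H := marginal_prod [set u] (fun _ _ => 1) f.
  rewrite [RHS]big_set1 in H; rewrite /w.
  under [RHS]eq_bigr do rewrite -[mu _]mulr1.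
  rewrite -H; apply: eq_bigr => g _.
  by rewrite !big_set1 mulr1.
move=> H; apply: le_trans (ler_wpM2l _ H) _.
  by rewrite mulr_ge0 ?exprn_ge0 // prodr_ge0 // => *; rewrite powR_ge0.
rewrite -/(bad S) badE exprD le_eqVlt; apply/orP; left; apply/eqP.
rewrite [LHS]mulrACA [w ^+ _ * w ^+ _]mulrC; congr (_ * _).
rewrite mulrC; congr (_ * _); last first.
  apply: eq_bigr => j /andP[jO uj]; congr (_ `^ _); rewrite /G.
  suff -> : S' :&: Nb j = S :&: Nb j by [].
  apply/setP => v; rewrite !inE; case: eqP => // ->.
  by rewrite (negbTE uj) !andbF.
apply: eq_big => j; first by rewrite inE.
rewrite inE => /andP[jO uj]; congr (_ `^ _).
have -> : S :&: Nb j = [set u] :|: S' :&: Nb j.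
  by rewrite SE setIUl; congr (_ :|: _); apply/setIidPl; rewrite sub1set.
rewrite marginal_setU; last by rewrite disjoints1 !inE eqxx.
by apply: eq_bigr => g _; rewrite big_set1.
Qed.

End Marginal.

(** * One vertex and its neighbourhood *)

Section Target.
Context {R : realType} {VH : finType} {eH : rel VH}.
Implicit Types (lam : VH -> R) (A B : {set VH}).

Lemma wset_ge0 lam A : (forall i, 0 <= lam i) -> 0 <= wset lam A.
Proof. by move=> lam0; exact: sumr_ge0. Qed.

Lemma wset_leT lam A : (forall i, 0 <= lam i) -> wset lam A <= \sum_i lam i.
Proof.
move=> lam0; rewrite [leRHS](bigID (mem A)) /= lerDl; exact: sumr_ge0.
Qed.

Lemma lam_le_wset lam A i : (forall i, 0 <= lam i) -> i \in A -> lam i <= wset lam A.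
Proof.
by move=> lam0 iA; rewrite /wset (bigD1 i) //= lerDl; exact: sumr_ge0.
Qed.

Lemma le_eta lam A B : joined eH A B -> wset lam A * wset lam B <= eta eH lam.
Proof.
exact: (@le_bigmax_cond _ R _ _ (A, B) (fun AB => joined eH AB.1 AB.2)
  (fun AB => wset lam AB.1 * wset lam AB.2)).
Qed.

Lemma mul_lam_le_eta lam i j : eH i j -> lam i * lam j <= eta eH lam.
Proof.
move=> ij; have := @le_eta lam [set i] [set j]; rewrite /wset !big_set1; apply.
apply/forallP => u; apply/implyP; rewrite inE => /eqP ->.
by apply/forallP => v; apply/implyP; rewrite inE => /eqP ->.
Qed.

(** The largest [B] joined to [A]. *)
Definition nbrs A : {set VH} := [set x | [forall y in A, eH y x]].

Lemma joined_nbrs A : joined eH A (nbrs A).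
Proof.
apply/forallP => u; apply/implyP => uA; apply/forallP => v; apply/implyP.
by rewrite inE => /forallP/(_ u); rewrite uA.
Qed.

Lemma eta_ge1 lam : (forall i, 1 <= lam i) -> (exists i j, eH i j) -> 1 <= eta eH lam.
Proof.
move=> lam1 [i [j ij]]; apply: le_trans (mul_lam_le_eta lam ij).
by rewrite -[leLHS]mulr1 ler_pM.
Qed.

Lemma sum_lam_ge1 lam : (forall i, 1 <= lam i) -> (exists i j, eH i j) ->
  1 <= \sum_i lam i.
Proof.
move=> lam1 [i _]; apply: le_trans (lam1 i) _; rewrite (bigD1 i) //= lerDl.
by apply: sumr_ge0 => j _; exact: le_trans (lam1 j).
Qed.

Lemma eta_leW lam : (forall i, 0 <= lam i) -> eta eH lam <= (\sum_i lam i) ^+ 2.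
Proof.
move=> lam0; apply: bigmax_le => [|[A B] _ /=].
  by rewrite exprn_ge0 // sumr_ge0.
by rewrite expr2 ler_pM ?wset_ge0 ?wset_leT.
Qed.

(** The exponent [d] on both factors would give [eta `^ d]; the mismatch between
    [n] and [d] is corrected by powers of the total mass. The empty [A], which
    arises only from an isolated vertex ([n = 0]), is where this correction is
    genuinely paid when [n < d]. *)
Lemma class_bound lam A n (d : R) : (forall i, 1 <= lam i) -> (exists i j, eH i j) ->
  0 < d -> (A == set0) ==> (n == 0)%N ->
  wset lam (nbrs A) `^ d * wset lam A ^+ n <=
  eta eH lam `^ d * (\sum_i lam i) `^ `|n%:R - d|.
Proof.
move=> lam1 edge d0 An.
have lam0 i : 0 <= lam i by exact: le_trans (lam1 i).
have eta1 := eta_ge1 lam1 edge.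
have eta0 : 0 <= eta eH lam by exact: le_trans eta1.
set W := \sum_i lam i.
have W1 : 1 <= W by exact: sum_lam_ge1 lam1 edge.
have W0 : 0 <= W by exact: le_trans W1.
have etad : 1 <= eta eH lam `^ d by rewrite -(powRr0 (eta eH lam)) ler_powR // ltW.
have bW := wset_leT (nbrs A) lam0.
have b0 := wset_ge0 (nbrs A) lam0.
have [A0|/set0Pn[i iA]] := eqVneq A set0.
  move: An; rewrite A0 eqxx /= => /eqP ->; rewrite expr0 mulr1 sub0r normrN gtr0_norm //.
  rewrite -A0; apply: le_trans (ler_peMl (powR_ge0 _ _) etad).
  by apply: ge0_ler_powR; rewrite ?nnegrE // ltW.
have a1 : 1 <= wset lam A by exact: le_trans (lam1 i) (lam_le_wset lam0 iA).
have a0 : 0 <= wset lam A by exact: le_trans a1.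
have aW := wset_leT A lam0.
have an0 : wset lam A != 0 by rewrite gt_eqF // (lt_le_trans ltr01).
have abd : wset lam (nbrs A) `^ d * wset lam A `^ d <= eta eH lam `^ d.
  rewrite -powRM // mulrC; apply: ge0_ler_powR; rewrite ?nnegrE ?mulr_ge0 ?(ltW d0) //.
  exact: le_eta (joined_nbrs A).
rewrite -powR_mulrn //; have [dn|/ltW nd] := lerP d n%:R.
  have -> : wset lam A `^ n%:R = wset lam A `^ d * wset lam A `^ (n%:R - d).
    by rewrite -powRD ?an0 ?implybT // addrC subrK.
  rewrite mulrA; apply: ler_pM => //; rewrite ?mulr_ge0 ?powR_ge0 //.
  by apply: ge0_ler_powR; rewrite ?nnegrE ?subr_ge0.
have Wp : 1 <= W `^ (d - n%:R) by rewrite -[leLHS](powRr0 W) ler_powR // subr_ge0.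
apply: le_trans (ler_peMr (powR_ge0 _ _) Wp).
apply: le_trans abd; apply: ler_wpM2l; first exact: powR_ge0.
by rewrite ler_powR.
Qed.

Context {V : finType}.

(** The total weight of the colours available to a vertex whose neighbours [S]
    are coloured by [g]. *)
Definition ext_weight lam (S : {set V}) (g : {ffun V -> VH}) : R :=
  \sum_x lam x * [forall u in S, eH (g u) x]%:R.

Lemma ext_weight_ge0 lam S g : (forall i, 0 <= lam i) -> 0 <= ext_weight lam S g.
Proof. by move=> l0; apply: sumr_ge0 => x _; rewrite mulr_ge0. Qed.

Lemma ext_weight_dep lam S : depends_on S (ext_weight lam S).
Proof.
move=> f g fg; apply: eq_bigr => x _; congr (_ * _%:R); congr (nat_of_bool _).
by apply: eq_forallb => u; case: (boolP (u \in S)) => //= /fg ->.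
Qed.

Lemma ext_weightE lam S g : ext_weight lam S g = wset lam (nbrs (g @: S)).
Proof.
rewrite /wset [RHS]big_mkcond; apply: eq_bigr => x _; rewrite inE.
have -> : [forall y in g @: S, eH y x] = [forall u in S, eH (g u) x].
  apply/forallP/forallP => H u; apply/implyP => uS.
    by have := H (g u); rewrite imset_f.
  by have /imsetP[v vS ->] := uS; have := H v; rewrite vS.
by case: ifP; rewrite ?mulr1 ?mulr0.
Qed.

(** Up to the choice of the image [A] of [S], which is one of at most
    [2 ^ #|VH|] sets, the left side counts colourings of [K_{n,d}] with [n] vertices
    coloured in [A] and [d] vertices coloured in [nbrs A]. *)
Lemma star_bound lam (S : {set V}) (d : R) f :
  (forall i, 1 <= lam i) -> (exists i j, eH i j) -> 0 < d ->
  marginal lam S (fun g => ext_weight lam S g `^ d) f <=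
  2 ^+ #|VH| * (eta eH lam `^ d * (\sum_i lam i) `^ `|#|S|%:R - d|).
Proof.
move=> lam1 edge d0.
have lam0 i : 0 <= lam i by exact: le_trans (lam1 i).
(* The sets that can be the image of [S]. *)
pose ok A := (A == set0 :> {set VH}) ==> (#|S| == 0)%N.
apply: (@le_trans _ _ (marginal lam S (fun g => \sum_(A | ok A)
   wset lam (nbrs A) `^ d * \prod_(u in S) (g u \in A)%:R) f)).
  apply: le_marginal => // g; rewrite ext_weightE.
  rewrite (bigD1 (g @: S)) /=; last first.
    by rewrite /ok imset_eq0 cards_eq0 implybb.
  rewrite big1; last by move=> u uS; rewrite imset_f.
  rewrite mulr1 lerDl; apply: sumr_ge0 => A _.
  by rewrite mulr_ge0 ?powR_ge0 // prodr_ge0.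
rewrite /marginal.
under eq_bigr do rewrite mulr_sumr.
rewrite exchange_big /=.
apply: (@le_trans _ _ (\sum_(A : {set VH} | ok A)
    eta eH lam `^ d * (\sum_i lam i) `^ `|#|S|%:R - d|)).
  apply: ler_sum => A okA; apply: le_trans (class_bound lam1 edge d0 okA).
  under eq_bigr do rewrite mulrCA.
  rewrite -mulr_sumr; apply: ler_wpM2l; first exact: powR_ge0.
  have := marginal_prod lam S (fun _ x => (x \in A)%:R) f; rewrite /marginal => ->.
  rewrite prodr_const le_eqVlt; apply/orP; left; apply/eqP; congr (_ ^+ _).
  rewrite /wset [RHS]big_mkcond; apply: eq_bigr => x _.
  by case: ifP; rewrite ?mulr1 ?mulr0.
rewrite sumr_const -[leLHS]mulr_natl; apply: ler_wpM2r.
  by rewrite mulr_ge0 ?powR_ge0.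
rewrite -natrX ler_nat -cardsT -card_powerset powersetT cardsT; exact: max_card.
Qed.

End Target.

(** * The partition function of a bipartite graph *)

Section Bipartite.
Context {R : realType} {VH V : finType} {eH : rel VH} {eG : rel V} {E O : {set V}}.
Hypothesis eH_sym : symmetric eH.
Hypothesis eG_sym : symmetric eG.
Hypothesis bip : bipartition eG E O.
Implicit Types (lam : VH -> R) (d : R).

Definition nbhd v : {set V} := [set u | eG v u].

Lemma bipartition_partition : E :|: O = setT /\ [disjoint E & O].
Proof. by case: bip. Qed.

Lemma nbhdO_subE v : v \in O -> nbhd v \subset E.
Proof.
case: bip => EO _ _ OO vO; apply/subsetP => u; rewrite inE => vu.
have : u \in E :|: O by rewrite EO inE.
by rewrite inE => /orP[//|uO]; have := OO v u vO uO; rewrite vu.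
Qed.

Lemma degreeE u : u \in E -> #|[set v in O | u \in nbhd v]| = degree eG u.
Proof.
case: bip => EO _ EE _ uE; apply: eq_card => v; rewrite !inE eG_sym.
have [uv|] := boolP (eG u v); last by rewrite andbF.
have : v \in E :|: O by rewrite EO inE.
by rewrite inE andbT => /orP[vE|//]; have := EE u v uE vE; rewrite uv.
Qed.

Lemma sum_degree : (\sum_(u in E) degree eG u = \sum_(v in O) degree eG v)%N.
Proof.
rewrite -(eq_bigr _ degreeE).
under eq_bigr do rewrite -sum1_card.
rewrite (exchange_big_dep (mem O)) /=; last by move=> u v _; rewrite inE => /andP[].
apply: eq_bigr => v vO; rewrite sum1_card; apply: eq_card => u.
rewrite unfold_in !inE /= vO /=; have [vu|] := boolP (eG v u); last by rewrite andbF.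
by rewrite (subsetP (nbhdO_subE vO)) // inE.
Qed.

Lemma card_bipartition : (#|V| = #|E| + #|O|)%N.
Proof.
have [EO dEO] := bipartition_partition.
by rewrite -cardsT -EO cardsU disjoint_setI0 // cards0 subn0.
Qed.

(** Since [`|x| = 2 x^+ - x], it suffices to bound the degree sum over [O] from
    below; by double counting it equals the degree sum over [E], where all but few
    vertices have degree at least [d]. In particular this controls the vertices of
    low degree in [O], which do not appear explicitly in [hfun]. *)
Lemma sum_dist_degree d : 0 < d ->
  \sum_(v in O) `|(degree eG v)%:R - d| <=
  2 * \sum_(v in O | d <= (degree eG v)%:R) ((degree eG v)%:R - d)
  + d * (#|O|%:R - #|E|%:R + #|[set v in E | ((degree eG v)%:R < d)%R]|%:R).
Proof.
move=> d0.
have H1 : \sum_(v in O) `|(degree eG v)%:R - d| =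
   2 * \sum_(v in O | d <= (degree eG v)%:R) ((degree eG v)%:R - d)
   + (d * #|O|%:R - \sum_(v in O) (degree eG v)%:R).
  rewrite mulr_natr -sumr_const -sumrB big_mkcondr /= mulr_sumr -big_split /=.
  apply: eq_bigr => v _; case: lerP => dv; last by ring.
  by ring.
have H2 : d * (#|E|%:R - #|[set v in E | ((degree eG v)%:R < d)%R]|%:R) <=
    \sum_(v in O) ((degree eG v)%:R : R).
  rewrite -natr_sum -sum_degree natr_sum.
  have -> : #|[set v in E | ((degree eG v)%:R < d)%R]|%:R =
      \sum_(v in E) ((degree eG v)%:R < d)%R%:R :> R.
    rewrite -sum1_card natr_sum big_mkcond [RHS]big_mkcond; apply: eq_bigr => v _.
    by rewrite inE; case: (v \in E) => //=; case: ifP.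
  rewrite -sum1_card natr_sum -sumrB mulr_sumr; apply: ler_sum => v vE.
  by case: ltP => dv; rewrite ?subrr ?mulr0 ?subr0 ?mulr1.
rewrite H1 lerD2l; move: H2; lra.
Qed.

Lemma mul_hfun d : (0 < #|V|)%N -> 0 < d ->
  #|V|%:R * hfun eG E O d =
  #|V|%:R / d + #|[set v in E | ((degree eG v)%:R < d)%R]|%:R
  + (#|O|%:R - #|E|%:R)
  + (\sum_(v in O | d <= (degree eG v)%:R) ((degree eG v)%:R - d)) / d.
Proof.
move=> V0 d0; rewrite /hfun.
have N0 : #|V|%:R != 0 :> R by rewrite pnatr_eq0 -lt0n.
have d1 : d != 0 by rewrite gt_eqF.
by field; rewrite d1 N0.
Qed.

Lemma hfun_gt0 d : (#|E| <= #|O|)%N -> 0 < d -> 0 < hfun eG E O d.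
Proof.
move=> EO d0; rewrite /hfun.
apply: ltr_pwDl; last first.
  rewrite mulr_ge0 ?invr_ge0 ?mulr_ge0 ?(ltW d0) //.
  by apply: sumr_ge0 => v /andP[_]; rewrite subr_ge0.
rewrite ltr_wpDr ?divr_ge0 ?subr_ge0 ?ler_nat //.
by rewrite ltr_wpDr ?divr_ge0 // invr_gt0.
Qed.

Lemma HomG_bipartition (g : {ffun V -> VH}) :
  (g \in HomG eG eH) = [forall v in O, [forall u in nbhd v, eH (g u) (g v)]].
Proof.
have [EO dEO] := bipartition_partition.
rewrite inE; apply/forallP/forallP => H v.
  apply/implyP => vO; apply/forallP => u; apply/implyP; rewrite inE => vu.
  by rewrite eH_sym; have /forallP/(_ u) := H v; rewrite vu.
apply/forallP => u; apply/implyP => vu.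
have HO w w' : w \in O -> eG w w' -> eH (g w') (g w).
  by move=> wO ww'; have := H w; rewrite wO => /forallP/(_ w'); rewrite inE ww'.
have : v \in E :|: O by rewrite EO inE.
rewrite inE => /orP[vE|vO]; last by rewrite eH_sym; exact: HO.
apply: HO; last by rewrite eG_sym.
have : u \in E :|: O by rewrite EO inE.
rewrite inE => /orP[uE|//]; case: bip => _ _ /(_ v u vE uE).
by rewrite vu.
Qed.

(** Once [E] is coloured, the vertices of [O] choose their colours independently. *)
Lemma Zfun_marginal lam f :
  Zfun eG eH lam =
  marginal lam E (fun g => \prod_(v in O) ext_weight (eH := eH) lam (nbhd v) g) f.
Proof.
have [EO dEO] := bipartition_partition.
pose hom (g : {ffun V -> VH}) v x : R := [forall u in nbhd v, eH (g u) x]%:R.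
transitivity (marginal lam (E :|: O) (fun g => \prod_(v in O) hom g v (g v)) f).
  rewrite EO /Zfun /marginal big_mkcond [RHS]big_mkcond /=.
  apply: eq_bigr => g _.
  have -> : eq_off setT f g by apply/eq_offP => v; rewrite inE.
  have -> : \prod_(v in [set: V]) lam (g v) = weight lam g.
    by apply: eq_bigl => v; rewrite inE.
  rewrite HomG_bipartition; case: forallP => [H|/forallP].
    rewrite big1 ?mulr1 // => v vO; rewrite /hom.
    by have := H v; rewrite vO => /= ->.
  rewrite negb_forall => /existsP[v]; rewrite negb_imply => /andP[vO nv].
  by rewrite (bigD1 v) //= /hom (negbTE nv) mul0r mulr0.
rewrite marginal_setU //; apply: eq_bigr => g _; congr (_ * _).
transitivity (marginal lam O (fun h => \prod_(v in O) hom g v (h v)) g); last first.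
  exact: (marginal_prod lam O (hom g)).
apply: eq_bigr => h /eq_offP hg; congr (_ * _).
apply: eq_bigr => v vO; congr (_%:R); congr (nat_of_bool _).
apply: eq_forallb => u; case: (boolP (u \in nbhd v)) => //= uv.
rewrite hg // (disjointFr dEO) //.
exact: (subsetP (nbhdO_subE vO)).
Qed.

(** [finner_inequality] applied to the neighbourhoods of the vertices of [O],
    together with [star_bound] for each of them. The exponents then add up to
    [#|O| * ln eta] plus errors, and every error is a multiple of [#|V| * hfun].
    Weights at least 1 make [holder_cover] applicable, and they allow extra factors
    [wset lam A] to be inserted at vertices of [O] of degree below [d]. *)
Lemma Zfun_le_ge1 lam d : (forall i, 1 <= lam i) -> (exists i j, eH i j) ->
  (0 < #|V|)%N -> (#|E| <= #|O|)%N -> 0 < d ->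
  Zfun eG eH lam <= expR (#|V|%:R / 2 * ln (eta eH lam)
    + (#|VH|%:R * ln 2 + 2 * ln (\sum_i lam i)) * (#|V|%:R * hfun eG E O d)).
Proof.
move=> lam1 edge V0 EO d0.
have lam0 i : 0 <= lam i by exact: le_trans (lam1 i).
have eta1 := eta_ge1 lam1 edge.
set W := \sum_i lam i.
have W1 : 1 <= W by exact: sum_lam_ge1 lam1 edge.
have [i0 _] := edge.
pose f : {ffun V -> VH} := [ffun=> i0].
have etaW : ln (eta eH lam) <= 2 * ln W.
  rewrite mulr_natl -lnXn; last exact: lt_le_trans W1.
  rewrite ler_ln ?posrE ?exprn_gt0 ?(lt_le_trans ltr01) //.
  exact: eta_leW.
set L := ln W; set l := ln (eta eH lam); set K := #|VH|%:R * ln 2.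
have L0 : 0 <= L by exact: ln_ge0.
have K0 : 0 <= K by rewrite mulr_ge0 // ln_ge0 // ler1n.
have expl : expR l = eta eH lam by rewrite lnK // posrE (lt_le_trans ltr01).
have expL : expR L = W by rewrite lnK // posrE (lt_le_trans ltr01).
rewrite (Zfun_marginal _ f).
pose F v g := ext_weight (eH := eH) lam (nbhd v) g `^ d.
have -> : marginal lam E (fun g => \prod_(v in O) ext_weight (eH := eH) lam (nbhd v) g) f =
    marginal lam E (fun g => \prod_(v in O) F v g `^ d^-1) f.
  apply: eq_bigr => g _; congr (_ * _); apply: eq_bigr => v _.
  by rewrite -powRrM divff ?gt_eqF // powRr1 // ext_weight_ge0.
have F0 v g : 0 <= F v g by exact: powR_ge0.
have FN v : v \in O -> depends_on (nbhd v) (F v).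
  by move=> _ g h gh; rewrite /F (ext_weight_dep lam gh).
apply: le_trans (finner_inequality (Nb := nbhd) E f d0 lam1 F0 FN) _.
set bad := #|[set v in E | ((degree eG v)%:R < d)%R]|.
have -> : #|[set u in E | (#|[set v in O | u \in nbhd v]|%:R < d)%R]| = bad.
  apply: eq_card => u; rewrite !inE; case: (boolP (u \in E)) => //= uE.
  by rewrite degreeE.
have star v : v \in O -> marginal lam (E :&: nbhd v) (F v) f `^ d^-1 <=
    expR ((K + d * l + L * `|(degree eG v)%:R - d|) / d).
  move=> vO; rewrite (setIidPr (nbhdO_subE vO)) [leRHS]expRM.
  apply: ge0_ler_powR; rewrite ?nnegrE ?expR_ge0 ?invr_ge0 ?(ltW d0) ?marginal_ge0 //.
  apply: le_trans (star_bound _ _ lam1 edge d0) _.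
  have -> : 2 ^+ #|VH| = expR K by rewrite /K expRM_natl lnK ?posrE.
  have -> : eta eH lam `^ d = expR (d * l) by rewrite mulrC expRM expl.
  have -> : W `^ `|#|nbhd v|%:R - d| = expR (L * `|#|nbhd v|%:R - d|).
    by rewrite expRM expL.
  by rewrite -!expRD addrA.
apply: (@le_trans _ _ (expR L ^+ bad *
    \prod_(v in O) expR ((K + d * l + L * `|(degree eG v)%:R - d|) / d))).
  rewrite expL; apply: ler_wpM2l; first by rewrite exprn_ge0 // (le_trans _ W1).
  by apply: ler_prod => v vO; rewrite powR_ge0 star.
rewrite -expR_sum -expRM_natl -expRD ler_expR.
rewrite -mulr_suml big_split /= sumr_const -mulr_sumr mul_hfun //.
rewrite -/bad.
have := sum_dist_degree d0; rewrite -/bad.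
set D := \sum_(v in O) _; set P := \sum_(v in O | _) _ => DP.
have Dd : D / d <= 2 * (P / d) + (#|O|%:R - #|E|%:R + bad%:R).
  rewrite ler_pdivrMr // mulrDl -[2 * _ * _]mulrA divfK ?gt_eqF //.
  by rewrite [X in _ <= _ + X]mulrC.
have cV : #|V|%:R = #|E|%:R + #|O|%:R :> R by rewrite card_bipartition natrD.
have EOr : 0 <= #|O|%:R - #|E|%:R :> R by rewrite subr_ge0 ler_nat.
have P0 : 0 <= P / d.
  rewrite divr_ge0 ?(ltW d0) //.
  by apply: sumr_ge0 => v /andP[_]; rewrite subr_ge0.
have -> : bad%:R * L + ((K + d * l) *+ #|O| + L * D) / d =
    bad%:R * L + K * (#|O|%:R / d) + l * #|O|%:R + L * (D / d).
  by rewrite -mulr_natr; field; rewrite gt_eqF.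
have b0 : 0 <= bad%:R :> R by [].
have Nd : 0 <= #|E|%:R / d by rewrite divr_ge0 // ltW.
have Od : 0 <= #|O|%:R / d by rewrite divr_ge0 // ltW.
have -> : #|V|%:R / d = #|E|%:R / d + #|O|%:R / d by rewrite cV mulrDl.
rewrite cV.
move: (ler_wpM2l L0 Dd) (ler_wpM2r EOr etaW) (mulr_ge0 K0 b0) (mulr_ge0 K0 EOr).
move: (mulr_ge0 K0 P0) (mulr_ge0 K0 Nd) (mulr_ge0 L0 Nd) (mulr_ge0 L0 Od).
rewrite -/L -/l.
move: (D / d) (P / d) (#|E|%:R / d) (#|O|%:R / d) => Dd' p e o.
lra.
Qed.


End Bipartite.

Section TwoSided.
Context {R : realType} {VH V : finType} {eH : rel VH} {eG : rel V} {E O : {set V}}.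
Hypothesis eH_sym : symmetric eH.
Hypothesis eH_edge : exists i j, eH i j.
Hypothesis eG_sym : symmetric eG.
Hypothesis bip : bipartition eG E O.
Hypothesis EO_card : (#|E| <= #|O|)%N.
Implicit Types (lam : VH -> R) (d : R).

Lemma eta_gt0 lam : (forall i, 0 < lam i) -> 0 < eta eH lam.
Proof.
move=> lam0; have [i [j ij]] := eH_edge.
by apply: lt_le_trans (mul_lam_le_eta lam ij); rewrite mulr_gt0.
Qed.

(** Homogeneity reduces this to weights at least 1: dividing [lam] by [m] divides
    the partition function by [m ^+ #|V|] and [eta] by [m ^+ 2]. *)
Lemma Zfun_le lam d m : 0 < m -> (forall i, m <= lam i) ->
  (0 < #|V|)%N -> 0 < d ->
  Zfun eG eH lam <= expR (#|V|%:R / 2 * ln (eta eH lam)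
    + (#|VH|%:R * ln 2 + 2 * ln ((\sum_i lam i) / m)) * (#|V|%:R * hfun eG E O d)).
Proof.
move=> m0 mlam V0 d0.
have lam0 i : 0 < lam i by exact: lt_le_trans (mlam i).
pose lam' i := lam i / m.
have lam1 i : 1 <= lam' i by rewrite /lam' ler_pdivlMr // mul1r.
have -> : Zfun eG eH lam = m ^+ #|V| * Zfun eG eH lam'.
  rewrite /Zfun mulr_sumr; apply: eq_bigr => f _; rewrite /weight.
  rewrite -prodr_const -big_split /=; apply: eq_bigr => v _.
  by rewrite /lam' mulrC divfK // gt_eqF.
have eta0 := eta_gt0 lam0.
have etam : eta eH lam' <= eta eH lam / m ^+ 2.
  apply: bigmax_le => [|[A B] /= AB]; first by rewrite divr_ge0 ?exprn_ge0 // ltW.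
  have -> : wset lam' A * wset lam' B = wset lam A * wset lam B / m ^+ 2.
    by rewrite /wset /lam' -!mulr_suml expr2 invfM mulrACA.
  by rewrite ler_pM2r ?invr_gt0 ?exprn_gt0 // le_eta.
have eta1 := eta_ge1 lam1 eH_edge.
have lneta : ln (eta eH lam') <= ln (eta eH lam) - 2 * ln m.
  rewrite mulr_natl -lnXn // -ln_div ?posrE ?exprn_gt0 //.
  by rewrite ler_ln ?posrE ?divr_gt0 ?exprn_gt0 // (lt_le_trans ltr01).
have -> : m ^+ #|V| = expR (#|V|%:R * ln m) by rewrite expRM_natl lnK.
have H := Zfun_le_ge1 eH_sym eG_sym bip lam1 eH_edge V0 EO_card d0.
apply: le_trans (ler_wpM2l (expR_ge0 _) H) _.
rewrite -expRD ler_expR addrA mulr_suml lerD2r.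
have N0 : 0 <= #|V|%:R / 2 :> R by rewrite divr_ge0.
have := ler_wpM2l N0 lneta; lra.
Qed.

Lemma joinedC A B : joined eH A B = joined eH B A.
Proof.
suff H C D : joined eH C D -> joined eH D C by apply/idP/idP; exact: H.
move=> CD; apply/forallP => u; apply/implyP => uD; apply/forallP => v; apply/implyP => vC.
by rewrite eH_sym; move/forallP/(_ v): CD; rewrite vC => /forallP/(_ u); rewrite uD.
Qed.

Lemma eta_attained lam : (forall i, 0 < lam i) -> exists A B,
  [/\ joined eH A B, wset lam A * wset lam B = eta eH lam & wset lam A <= wset lam B].
Proof.
move=> lam0; have lam0' i : 0 <= lam i by exact: ltW.
have [||[A B] /= AB etaE] := @eq_bigmax _ R _ 0 (set0, set0) (fun AB => joined eH AB.1 AB.2)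
    (fun AB => wset lam AB.1 * wset lam AB.2).
- by apply/forallP => u; rewrite inE.
- by move=> i; rewrite mulr_ge0 ?wset_ge0.
rewrite -/(eta eH lam) in etaE; rewrite etaE.
have [le|/ltW le] := lerP (wset lam A) (wset lam B); first by exists A, B.
by exists B, A; split=> //; [rewrite joinedC | rewrite mulrC].
Qed.

(** Colour [E] from [A] and [O] from [B], where [(A, B)] attains [eta]; giving the
    heavier set to the larger class beats the balanced power [eta `^ (#|V| / 2)]. *)
Lemma Zfun_ge lam : (forall i, 0 < lam i) ->
  expR (#|V|%:R / 2 * ln (eta eH lam)) <= Zfun eG eH lam.
Proof.
move=> lam0; have lam0' i : 0 <= lam i by exact: ltW.
have [A [B [AB etaE leAB]]] := eta_attained lam0.
have eta0 := eta_gt0 lam0.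
have A0 : 0 < wset lam A.
  rewrite lt0r wset_ge0 // andbT; apply: contraTneq eta0 => A0.
  by rewrite -etaE A0 mul0r ltxx.
have B0 : 0 < wset lam B by exact: lt_le_trans leAB.
have [EO dEO] := bipartition_partition bip.
apply: (@le_trans _ _ (wset lam A ^+ #|E| * wset lam B ^+ #|O|)).
  rewrite -etaE lnM // (card_bipartition bip) natrD.
  rewrite -[X in _ <= X ^+ _ * _](lnK A0) -[X in _ <= _ * X ^+ _](lnK B0).
  rewrite -!expRM_natl -expRD ler_expR.
  have : 0 <= (#|O|%:R - #|E|%:R) * (ln (wset lam B) - ln (wset lam A)).
    by rewrite mulr_ge0 ?subr_ge0 ?ler_nat // ler_ln.
  lra.
pose Q v x := if v \in E then x \in A else x \in B.
have -> : wset lam A ^+ #|E| * wset lam B ^+ #|O| =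
    \sum_(f in family Q) weight lam f.
  transitivity (\prod_v \sum_(x | Q v x) lam x); last by rewrite bigA_distr_big_dep.
  rewrite (bigID (mem E)) /= -!prodr_const; congr (_ * _).
    by apply: eq_bigr => v vE; apply: eq_bigl => x; rewrite /Q vE.
  have OE v : (v \in O) = (v \notin E).
    have : v \in E :|: O by rewrite EO inE.
    rewrite inE; case: (boolP (v \in E)) => //= vE _.
    by rewrite (disjointFr dEO vE).
  rewrite (eq_bigl _ _ OE); apply: eq_bigr => v vE; apply: eq_bigl => x.
  by rewrite /Q (negbTE vE).
rewrite /Zfun [leRHS]big_mkcond [leLHS]big_mkcond; apply: ler_sum => f _.
case: ifP => [/familyP fQ|_]; last first.
  by case: ifP => // _; rewrite prodr_ge0.
suff -> : f \in HomG eG eH by [].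
rewrite (HomG_bipartition eH_sym eG_sym bip).
apply/forallP => v; apply/implyP => vO; apply/forallP => u; apply/implyP => uv.
have uE := subsetP (nbhdO_subE bip vO) u uv.
have fuA : f u \in A by have : Q u (f u) := fQ u; rewrite /Q uE.
have fvB : f v \in B by have : Q v (f v) := fQ v; rewrite /Q (disjointFl dEO vO).
by move/forallP/(_ (f u)): AB; rewrite fuA => /forallP/(_ (f v)); rewrite fvB.
Qed.

End TwoSided.

(** * Tilting the weight of a colour *)

Section Tilt.
Context {R : realType} {VH : finType} {eH : rel VH}.
Hypothesis eH_sym : symmetric eH.
Hypothesis eH_edge : exists i j, eH i j.
Variable lam : VH -> R.
Hypothesis lam_gt0 : forall i, 0 < lam i.

(** Multiplying the weight of the colour [k] by [expR t] turns the partition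
    function into the Laplace transform of the number of vertices coloured [k]. *)
Definition tilt (k : VH) (t : R) (i : VH) : R := expR (t * (i == k)%:R) * lam i.

Lemma tilt_gt0 k t i : 0 < tilt k t i.
Proof. by rewrite mulr_gt0 ?expR_gt0. Qed.

Lemma weight_tilt (V : finType) k t (f : {ffun V -> VH}) :
  weight (tilt k t) f = expR (t * #|[set v | f v == k]|%:R) * weight lam f.
Proof.
rewrite /weight big_split /= -expR_sum -mulr_sumr; congr (expR (_ * _) * _).
rewrite -sum1_card natr_sum [RHS]big_mkcond; apply: eq_bigr => v _.
by rewrite inE; case: eqP.
Qed.

Lemma wset_tilt k t A :
  wset (tilt k t) A = wset lam A + (expR t - 1) * lam k * (k \in A)%:R.
Proof.
transitivity (\sum_(i in A) (lam i + (expR t - 1) * lam k * (i == k)%:R)).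
  apply: eq_bigr => i _; rewrite /tilt; case: eqP => [->|_]; first by rewrite !mulr1; ring.
  by rewrite !mulr0 expR0 mul1r addr0.
rewrite big_split -mulr_sumr; congr (_ + _ * _).
rewrite big_mkcond (bigD1 k) //= eqxx big1 ?addr0; first by case: (k \in A).
by move=> i /negbTE ->; case: ifP.
Qed.

Lemma expR_le_quadratic (t : R) : `|t| <= 2^-1 -> expR t <= 1 + t + 2 * t ^+ 2.
Proof.
move=> t2; have [t2a t2b] : - 2^-1 <= t /\ t <= 2^-1 by move: t2; rewrite ler_norml => /andP[].
have t1 : 0 < 1 - t by lra.
have : expR t <= (1 - t)^-1.
  rewrite -[expR t]invrK -expRN lef_pV2 ?posrE ?expR_gt0 //.
  exact: expR_ge1Dx.
move/le_trans; apply; rewrite -[_^-1]mul1r ler_pdivrMr //.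
have : 0 <= t ^+ 2 * (1 - 2 * t) by rewrite mulr_ge0 ?sqr_ge0 //; lra.
lra.
Qed.

Lemma occ_ge0 k AB : 0 <= occ lam k AB.
Proof.
by rewrite addr_ge0 ?mulr_ge0 ?wset_ge0 // => *; exact: ltW.
Qed.

(** Each of the two terms of [occ] is at most [wset lam AB.1 * wset lam AB.2]. *)
Lemma occ_le k AB : joined eH AB.1 AB.2 -> occ lam k AB <= 2 * eta eH lam.
Proof.
move=> J; have lam0 i : 0 <= lam i by exact: ltW.
have in_le (S : {set VH}) : lam k * (k \in S)%:R <= wset lam S.
  by case: (boolP (k \in S)) => kS; rewrite ?mulr1 ?mulr0 ?wset_ge0 ?lam_le_wset.
apply: (@le_trans _ _ (2 * (wset lam AB.1 * wset lam AB.2))).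
  rewrite mulr_natl mulr2n lerD // -mulrA; first by rewrite ler_wpM2l ?wset_ge0.
  by rewrite [leRHS]mulrC ler_wpM2l ?wset_ge0.
by rewrite ler_pM2l // le_eta.
Qed.

Lemma eta_gap : exists2 delta : R, 0 < delta & forall AB, joined eH AB.1 AB.2 ->
  AB \notin Mset eH lam -> wset lam AB.1 * wset lam AB.2 <= eta eH lam - delta.
Proof.
pose P (AB : {set VH} * {set VH}) := joined eH AB.1 AB.2 && (AB \notin Mset eH lam).
pose F (AB : {set VH} * {set VH}) := eta eH lam - wset lam AB.1 * wset lam AB.2.
exists (\big[Num.min/1]_(AB | P AB) F AB).
  apply: lt_bigmin => // AB /andP[J]; rewrite inE J /= /F subr_gt0 => ne.
  by rewrite lt_neqAle ne le_eta.
move=> AB J M; have PAB : P AB by rewrite /P J.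
have := @bigmin_le_cond _ R _ 1 AB P F PAB; rewrite /F; lra.
Qed.

(** The derivative of [wset A * wset B] along the tilt at [t = 0] is [occ], so
    optimal pairs grow at rate at most [q] up to a quadratic error. A pair that is
    not optimal starts below [eta] by a fixed gap; it can catch up only linearly in
    [t], and a large enough multiple of [t ^+ 2] plus the gap absorbs that. *)
Lemma eta_tilt_le : exists2 C : R, 0 <= C & forall k (t q : R), `|t| <= 2^-1 ->
  0 <= q <= 2 * eta eH lam ->
  (forall AB, AB \in Mset eH lam -> t * occ lam k AB <= t * q) ->
  eta eH (tilt k t) <= eta eH lam + t * q + C * t ^+ 2.
Proof.
have [delta d0 gap] := eta_gap.
have eta0 := eta_gt0 eH_edge lam_gt0.
have lam0 i : 0 <= lam i by exact: ltW.
set h := eta eH lam in eta0 gap *; set W := \sum_i lam i.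
have W0 : 0 <= W by exact: sumr_ge0.
(* The terms absorb the second-order part of [expR t - 1], its square, and
   the linear growth of the pairs that are not optimal. *)
exists (4 * h + 4 * W ^+ 2 + 4 * h ^+ 2 / delta).
  by rewrite !addr_ge0 ?mulr_ge0 ?invr_ge0 ?exprn_ge0 // ltW.
move=> k t q t2 /andP[q0 qh] tq.
have tq_ge : - (2 * h * `|t|) <= t * q.
  rewrite lerNl -mulNr; apply: le_trans (ler_norm _) _; rewrite normrM normrN.
  by rewrite mulrC ler_wpM2r // ger0_norm.
have amgm : 4 * h * `|t| <= 4 * h ^+ 2 / delta * t ^+ 2 + delta.
  have E : 4 * h ^+ 2 / delta * t ^+ 2 * delta = (2 * h * `|t|) ^+ 2.
    by rewrite !exprMn real_normK ?num_real //; field; rewrite gt_eqF.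
  rewrite -(ler_pM2r d0); have := sqr_ge0 (2 * h * `|t| - delta); lra.
have nt0 := normr_ge0 t.
have t20 : 0 <= t ^+ 2 by exact: sqr_ge0.
have hW0 : 0 <= h * t ^+ 2 by rewrite mulr_ge0 // ltW.
have WW0 : 0 <= W ^+ 2 * t ^+ 2 by rewrite mulr_ge0 ?sqr_ge0.
have hd0 : 0 <= 4 * h ^+ 2 / delta * t ^+ 2.
  by rewrite mulr_ge0 // divr_ge0 ?(ltW d0) // mulr_ge0 ?sqr_ge0.
apply: bigmax_le => [|[A B] /= J].
  rewrite -[t * q]opprK; have : `|t| <= 2^-1 by [].
  have : 0 <= h * (1 - 2 * `|t|) by rewrite mulr_ge0 ?(ltW eta0) //; lra.
  lra.
set z := expR t - 1.
have z1 : t <= z by have := expR_ge1Dx t; rewrite /z; lra.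
have z2 : z <= t + 2 * t ^+ 2 by have := expR_le_quadratic t2; rewrite /z; lra.
have z22 : z ^+ 2 <= 4 * t ^+ 2.
  have -> : 4 * t ^+ 2 = (2 * `|t|) ^+ 2 by rewrite exprMn real_normK ?num_real //; ring.
  rewrite -[leLHS]real_normK ?num_real // lerXn2r ?nnegrE ?mulr_ge0 //.
  rewrite ler_norml; have := ler_norm t; have := ler_norm (- t); rewrite normrN.
  have : t ^+ 2 <= `|t| / 2 by rewrite -[leLHS]real_normK ?num_real // expr2 ler_wpM2l.
  lra.
have -> : wset (tilt k t) A * wset (tilt k t) B =
    wset lam A * wset lam B + z * occ lam k (A, B)
    + z ^+ 2 * (lam k * (k \in A)%:R * (lam k * (k \in B)%:R)).
  by rewrite !wset_tilt /occ /= -/z; ring.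
have o0 := occ_ge0 k (A, B).
have o2 : occ lam k (A, B) <= 2 * h by exact: occ_le.
have zo : z * occ lam k (A, B) <= t * occ lam k (A, B) + 4 * h * t ^+ 2.
  have := ler_wpM2r o0 z2; have := ler_wpM2l t20 o2; lra.
have in_le (S : {set VH}) : 0 <= lam k * (k \in S)%:R <= W.
  rewrite mulr_ge0 //= /W (bigD1 k) //=.
  apply: ler_wpDr; first exact: sumr_ge0.
  by case: (k \in S); rewrite ?mulr1 ?mulr0.
have [/andP[a0 a1] /andP[b0 b1]] := (in_le A, in_le B).
have zz : z ^+ 2 * (lam k * (k \in A)%:R * (lam k * (k \in B)%:R)) <= 4 * (W ^+ 2 * t ^+ 2).
  have -> : 4 * (W ^+ 2 * t ^+ 2) = 4 * t ^+ 2 * (W * W) by ring.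
  by apply: ler_pM; rewrite ?sqr_ge0 ?(mulr_ge0 a0 b0) //; apply: ler_pM.
have [M|M] := boolP ((A, B) \in Mset eH lam).
  have := tq _ M; have := le_eta lam J; rewrite -/h; lra.
have /= := gap (A, B) J M.
have : t * occ lam k (A, B) <= 2 * h * `|t|.
  apply: le_trans (ler_norm _) _; rewrite normrM mulrC ler_wpM2r // ger0_norm //.
lra.
Qed.

End Tilt.

Section Mgf.
Context {R : realType} {VH : finType} {eH : rel VH}.
Hypothesis eH_sym : symmetric eH.
Hypothesis eH_edge : exists i j, eH i j.
Variable lam : VH -> R.
Hypothesis lam_gt0 : forall i, 0 < lam i.

Definition colour_count (V : finType) (k : VH) (f : {ffun V -> VH}) : R :=
  #|[set v | f v == k]|%:R.

(** The Laplace transform of [colour_count k]. *)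
Definition mgf (V : finType) (eG : rel V) (k : VH) (t : R) : R :=
  \sum_(f in HomG eG eH) expR (t * colour_count k f) * (weight lam f / Zfun eG eH lam).

Lemma mgfE (V : finType) (eG : rel V) k t :
  mgf eG k t = Zfun eG eH (tilt lam k t) / Zfun eG eH lam.
Proof.
rewrite [in RHS]/Zfun mulr_suml; apply: eq_bigr => f _.
by rewrite mulrA weight_tilt.
Qed.

Lemma tilt_bounds k (t : R) i : `|t| <= 2^-1 ->
  expR (- 1) * lam i <= tilt lam k t i <= expR 1 * lam i.
Proof.
rewrite ler_norml => /andP[t1 t2]; rewrite /tilt !ler_pM2r // !ler_expR.
by case: (i == k); rewrite ?mulr1 ?mulr0; apply/andP; split; lra.
Qed.

Lemma lam_bounded_below : exists2 m : R, 0 < m & forall i, m <= lam i.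
Proof.
exists (\big[Num.min/1]_i lam i); first by apply: lt_bigmin.
by move=> i; exact: bigmin_le.
Qed.

(** The Laplace transform is a ratio of partition functions: [Zfun_le] for the tilted
    weights over [Zfun_ge] for the original ones leaves, per vertex, half the
    increment of [ln eta], which [eta_tilt_le] controls, and the error [c * h].
    The constants are uniform because tilted weights stay within a factor [expR 1]
    of [lam]. *)
Lemma mgf_bound : exists c C : R, [/\ 0 < c, 1 <= C &
  forall (V : finType) (eG : rel V) (E O : {set V}) (d : R),
    symmetric eG -> bipartition eG E O -> (0 < #|V|)%N -> (#|E| <= #|O|)%N ->
    0 < d ->
  forall k (t q : R), `|t| <= 2^-1 -> 0 <= q <= 2 * eta eH lam ->
    (forall AB, AB \in Mset eH lam -> t * occ lam k AB <= t * q) ->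
  mgf eG k t <= expR (#|V|%:R *
    (t * (q / (2 * eta eH lam)) + C * t ^+ 2 + c * hfun eG E O d))].
Proof.
have [m m0 mlam] := lam_bounded_below.
have [C0 C00 etaT] := eta_tilt_le eH_edge lam_gt0.
have eta0 := eta_gt0 eH_edge lam_gt0.
set h := eta eH lam in eta0 etaT *.
pose W := \sum_i lam i.
have W0 : m <= W.
  have [i _] := eH_edge; apply: le_trans (mlam i) _.
  by rewrite /W (bigD1 i) //= lerDl; apply: sumr_ge0 => j _; exact: ltW.
pose m' := expR (- 1) * m.
have m'0 : 0 < m' by rewrite mulr_gt0 ?expR_gt0.
pose r := (expR 1 * W) / m'.
have r0 : 1 <= r.
  rewrite ler_pdivlMr // mul1r ler_pM ?(ltW m0) ?expR_ge0 // ler_expR; lra.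
exists (#|VH|%:R * ln 2 + 2 * ln r + 1), (1 + C0 / (2 * h)); split.
- by rewrite ltr_pwDr // addr_ge0 // mulr_ge0 // ln_ge0 // ler1n.
- by rewrite lerDl divr_ge0 // mulr_ge0 // ltW.
move=> V eG E O d eG_sym bip V0 EO d0 k t q t2 q2 tq.
have tilt0 i : 0 < tilt lam k t i by exact: tilt_gt0.
have mtilt i : m' <= tilt lam k t i.
  have /andP[+ _] := tilt_bounds k i t2; apply: le_trans.
  by rewrite ler_wpM2l ?expR_ge0.
have Wtilt : ln ((\sum_i tilt lam k t i) / m') <= ln r.
  have S0 : 0 < \sum_i tilt lam k t i.
    have [i _] := eH_edge; rewrite (bigD1 i) //=; apply: ltr_wpDr => //.
    by apply: sumr_ge0 => j _; exact: ltW.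
  rewrite ler_ln ?posrE ?(lt_le_trans ltr01 r0) ?divr_gt0 //.
  rewrite ler_pM2r ?invr_gt0 // mulr_sumr; apply: ler_sum => i _.
  by case/andP: (tilt_bounds k i t2).
have etat0 := eta_gt0 eH_edge tilt0.
have lneta : ln (eta eH (tilt lam k t)) <= ln h + (t * q + C0 * t ^+ 2) / h.
  rewrite -[leRHS]expRK ler_ln ?posrE ?expR_gt0 //.
  rewrite expRD lnK ?posrE //; apply: le_trans (etaT k t q t2 q2 tq) _.
  apply: le_trans (ler_wpM2l (ltW eta0) (expR_ge1Dx _)).
  rewrite mulrDr mulr1 [h * (_ / h)]mulrC divfK ?gt_eqF // addrA //.
rewrite mgfE ler_pdivrMr; last first.
  apply: lt_le_trans (Zfun_ge eH_sym eH_edge eG_sym bip EO lam_gt0).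
  exact: expR_gt0.
have Zge := Zfun_ge eH_sym eH_edge eG_sym bip EO lam_gt0.
apply: le_trans (ler_wpM2l (expR_ge0 _) Zge).
apply: le_trans (Zfun_le eH_sym eH_edge eG_sym bip EO m'0 mtilt V0 d0) _.
rewrite -expRD ler_expR -/h.
have h0 : 0 < hfun eG E O d by exact: hfun_gt0.
have N0 : 0 < #|V|%:R :> R by rewrite ltr0n.
have Nh : 0 < #|V|%:R * hfun eG E O d by rewrite mulr_gt0.
have N2 : 0 <= #|V|%:R / 2 :> R by rewrite divr_ge0.
have H1 := ler_wpM2l N2 lneta.
have H2 := ler_wpM2r (ltW Nh) Wtilt.
have Nt : 0 <= #|V|%:R * t ^+ 2 by rewrite mulr_ge0 ?sqr_ge0 // ltW.
have -> : #|V|%:R * (t * (q / (2 * h)) + (1 + C0 / (2 * h)) * t ^+ 2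
     + (#|VH|%:R * ln 2 + 2 * ln r + 1) * hfun eG E O d) + #|V|%:R / 2 * ln h =
   #|V|%:R / 2 * (ln h + (t * q + C0 * t ^+ 2) / h) + #|V|%:R * t ^+ 2
   + (#|VH|%:R * ln 2 + 2 * ln r + 1) * (#|V|%:R * hfun eG E O d).
  by field; rewrite gt_eqF.
move: H1 H2 Nh Nt.
move: (#|V|%:R * hfun eG E O d) => x; lra.
Qed.

Lemma occ_max_le k : occ_max eH lam k <= 2 * eta eH lam.
Proof.
have eta0 := eta_gt0 eH_edge lam_gt0.
apply: bigmax_le => [|AB]; first by rewrite mulr_ge0 // ltW.
by rewrite inE => /andP[J _]; exact: occ_le.
Qed.

Lemma occ_max_bounds k : 0 <= occ_max eH lam k <= 2 * eta eH lam.
Proof. by rewrite occ_max_le bigmax_ge_id. Qed.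

Lemma occ_min_bounds k : 0 <= occ_min eH lam k <= 2 * eta eH lam.
Proof.
have /andP[M0 M1] := occ_max_bounds k.
rewrite (le_trans (bigmin_le_id _ _ _ _) M1) andbT.
by apply: le_bigmin => // AB _; exact: occ_ge0.
Qed.

Section Fixed.
Context {V : finType} {eG : rel V}.
Hypothesis V_gt0 : (0 < #|V|)%N.
Hypothesis Z_gt0 : 0 < Zfun eG eH lam.
Let N : R := #|V|%:R.

Let pr (f : {ffun V -> VH}) := weight lam f / Zfun eG eH lam.

Lemma pr_ge0 f : 0 <= pr f.
Proof. by rewrite divr_ge0 ?(ltW Z_gt0) // prodr_ge0 // => v _; exact: ltW. Qed.

Lemma sum_pr : \sum_(f in HomG eG eH) pr f = 1.
Proof. by rewrite -mulr_suml divff // gt_eqF. Qed.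

Lemma pbarE k : N * pbar eG eH lam k = \sum_(f in HomG eG eH) pr f * colour_count k f.
Proof.
rewrite /pbar mulrA divff ?pnatr_eq0 -?lt0n // mul1r /prob.
under eq_bigr do rewrite big_mkcondr.
rewrite exchange_big; apply: eq_bigr => f _.
rewrite /colour_count -sum1_card natr_sum mulr_sumr [RHS]big_mkcond.
by apply: eq_bigr => v _; rewrite inE mulr1.
Qed.

(** Jensen's inequality for [expR], from its tangent line at the mean. *)
Lemma pbar_jensen k t : expR (t * (N * pbar eG eH lam k)) <= mgf eG k t.
Proof.
set mean := N * _.
have -> : mgf eG k t = expR (t * mean) *
    \sum_(f in HomG eG eH) pr f * expR (t * colour_count k f - t * mean).
  rewrite mulr_sumr; apply: eq_bigr => f _.
  by rewrite [RHS]mulrCA -expRD addrC subrK mulrC.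
rewrite ler_peMr ?expR_ge0 //.
apply: (@le_trans _ _ (\sum_(f in HomG eG eH)
    (pr f * (1 - t * mean) + t * (pr f * colour_count k f)))).
  rewrite big_split /= -mulr_suml -mulr_sumr sum_pr -pbarE -/mean; lra.
apply: ler_sum => f _.
apply: le_trans (ler_wpM2l (pr_ge0 f) (expR_ge1Dx _)).
by rewrite le_eqVlt; apply/orP; left; apply/eqP; ring.
Qed.

Lemma chernoff k (t y : R) (P : pred {ffun V -> VH}) :
  (forall f, P f -> t * (N * y) <= t * colour_count k f) ->
  prob eG eH lam P <= expR (- (t * (N * y))) * mgf eG k t.
Proof.
move=> PX; rewrite /prob big_mkcondr mulr_sumr; apply: ler_sum => f _.
case: ifPn => Pf; last exact: (mulr_ge0 (expR_ge0 _) (mulr_ge0 (expR_ge0 _) (pr_ge0 f))).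
rewrite mulrA -expRD ler_peMl ?pr_ge0 // -expR0 ler_expR addrC subr_ge0.
exact: PX.
Qed.

End Fixed.
End Mgf.

(** * Deviations and mean *)

Section Deviation.
Context {R : realType} {VH : finType} {eH : rel VH}.
Hypothesis eH_sym : symmetric eH.
Hypothesis eH_edge : exists i j, eH i j.
Variable lam : VH -> R.
Hypothesis lam_gt0 : forall i, 0 < lam i.

Lemma ratio_bounds (q h : R) : 0 < h -> 0 <= q <= 2 * h -> 0 <= q / (2 * h) <= 1.
Proof.
move=> h0 /andP[q0 q1]; have h20 : 0 < 2 * h by rewrite mulr_gt0.
by rewrite divr_ge0 ?(ltW h20) //= ler_pdivrMr // mul1r.
Qed.

Lemma aplus_bounds k : 0 <= aplus eH lam k <= 1.
Proof.
by apply: ratio_bounds; [exact: eta_gt0 | exact: occ_max_bounds].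
Qed.

Lemma aminus_bounds k : 0 <= aminus eH lam k <= 1.
Proof.
by apply: ratio_bounds; [exact: eta_gt0 | exact: occ_min_bounds].
Qed.

Lemma mul_occ_le_max k (t : R) AB : 0 <= t -> AB \in Mset eH lam ->
  t * occ lam k AB <= t * occ_max eH lam k.
Proof.
move=> t0 M; apply: ler_wpM2l => //.
exact: (@le_bigmax_cond _ R _ 0 AB (fun AB => AB \in Mset eH lam)).
Qed.

Lemma mul_occ_le_min k (t : R) AB : t <= 0 -> AB \in Mset eH lam ->
  t * occ lam k AB <= t * occ_min eH lam k.
Proof.
move=> t0 M; apply: ler_wnM2l => //.
exact: (@bigmin_le_cond _ R _ _ AB (fun AB => AB \in Mset eH lam)).
Qed.

Context {V : finType} {eG : rel V}.
Hypothesis V_gt0 : (0 < #|V|)%N.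
Hypothesis Z_gt0 : 0 < Zfun eG eH lam.
Let N : R := #|V|%:R.
Variables (c C h : R).
Hypotheses (c0 : 0 < c) (C1 : 1 <= C) (h0 : 0 < h).

(** Chernoff's bound for both tails at once: [s = 1] for the upper tail and
    [s = -1] for the lower one. The tilt [eps / (2 * C)] minimises
    [C * t ^+ 2 - t * eps], and half of the gain [eps ^+ 2 / (4 * C)] pays for the
    error [c * h]. *)
Lemma tail_bound k (a s eps : R) (P : pred {ffun V -> VH}) :
  s \in [:: 1; -1] -> 0 <= eps <= 1 -> c * h <= eps ^+ 2 / (8 * C) ->
  (forall t, `|t| <= 2^-1 -> 0 <= s * t ->
     mgf (eH := eH) lam eG k t <= expR (N * (t * a + C * t ^+ 2 + c * h))) ->
  (forall f, P f -> s * a + eps <= s * (colour_count k f / N)) ->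
  prob eG eH lam P <= expR (- (N * (eps ^+ 2 / (8 * C)))).
Proof.
move=> s1 /andP[e0 e1] ch mgfB PX.
have s2 : s * s = 1.
  by move: s1; rewrite !inE => /orP[]/eqP ->; ring.
have ns : `|s| = 1.
  by move: s1; rewrite !inE => /orP[]/eqP ->; rewrite ?normrN normr1.
have N0 : 0 < N by rewrite ltr0n.
have C0 : 0 < C by exact: lt_le_trans C1.
pose u := eps / (2 * C); pose t := s * u.
have u0 : 0 <= u by rewrite divr_ge0 ?mulr_ge0 // ltW.
have tu : `|t| = u by rewrite normrM ns mul1r ger0_norm.
have st : s * t = u by rewrite mulrA s2 mul1r.
have t12 : `|t| <= 2^-1.
  by rewrite tu ler_pdivrMr ?mulr_gt0 // mulKf ?pnatr_eq0 // (le_trans e1).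
have st0 : 0 <= s * t by rewrite st.
pose y := a + s * eps.
apply: le_trans (chernoff lam_gt0 Z_gt0 (k := k) (t := t) (y := y) _) _.
  move=> f /PX H; rewrite -[colour_count k f](@divfK _ N) ?gt_eqF //.
  have -> : t * (N * y) = u * N * (s * a + eps * (s * s)) by rewrite /t /y; ring.
  have -> : t * (colour_count k f / N * N) = u * N * (s * (colour_count k f / N)).
    by rewrite /t; ring.
  by rewrite s2 mulr1 ler_wpM2l // mulr_ge0 // ltW.
apply: le_trans (ler_wpM2l (expR_ge0 _) (mgfB t t12 st0)) _.
rewrite -expRD ler_expR.
have -> : - (t * (N * y)) + N * (t * a + C * t ^+ 2 + c * h) =
   N * (- (u * eps) * (s * s) + C * u ^+ 2 * (s * s) + c * h).
  by rewrite /t /y; ring.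
rewrite s2 !mulr1 -[leRHS]mulrN ler_pM2l //.
have -> : - (u * eps) + C * u ^+ 2 = - (2 * (eps ^+ 2 / (8 * C))).
  by rewrite /u; field; rewrite gt_eqF.
lra.
Qed.

(** The tilt [Num.sqrt h] balances the two errors [C * t] and [c * h / t]. *)
Lemma mean_bound k (a s : R) : s \in [:: 1; -1] -> Num.sqrt h <= 2^-1 ->
  (forall t, `|t| <= 2^-1 -> 0 <= s * t ->
     mgf (eH := eH) lam eG k t <= expR (N * (t * a + C * t ^+ 2 + c * h))) ->
  s * (pbar eG eH lam k - a) <= (C + c) * Num.sqrt h.
Proof.
move=> s1 h2 mgfB.
have s2 : s * s = 1.
  by move: s1; rewrite !inE => /orP[]/eqP ->; ring.
have ns : `|s| = 1.
  by move: s1; rewrite !inE => /orP[]/eqP ->; rewrite ?normrN normr1.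
have N0 : 0 < N by rewrite ltr0n.
pose u := Num.sqrt h; pose t := s * u.
have u0 : 0 < u by rewrite sqrtr_gt0.
have tu : `|t| = u by rewrite normrM ns mul1r ger0_norm // ltW.
have st : s * t = u by rewrite mulrA s2 mul1r.
have hu : h = u * u by rewrite -expr2 sqr_sqrtr // ltW.
have := mgfB t; rewrite tu st => /(_ h2 (ltW u0)).
move/(le_trans (pbar_jensen lam_gt0 V_gt0 Z_gt0 k t)).
rewrite ler_expR mulrCA ler_pM2l // => H; rewrite -(ler_pM2l u0) -/u; move: H.
have -> : t * a + C * t ^+ 2 + c * h = t * a + C * u ^+ 2 * (s * s) + c * (u * u).
  by rewrite {1}hu /t; ring.
have -> : u * (s * (pbar eG eH lam k - a)) = t * pbar eG eH lam k - t * a.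
  by rewrite /t; ring.
rewrite s2; lra.
Qed.

Lemma pbar_bounds k : 0 <= pbar eG eH lam k <= 1.
Proof.
have N0 : 0 < N by rewrite ltr0n.
rewrite -(ler_pM2l N0) -(ler_pM2l N0 _ 1) mulr0 mulr1 pbarE //.
apply/andP; split; first by apply: sumr_ge0 => f _; rewrite mulr_ge0 // pr_ge0.
rewrite -[leRHS]mul1r -(sum_pr Z_gt0) mulr_suml; apply: ler_sum => f _.
rewrite ler_wpM2l ?pr_ge0 // ler_nat; exact: max_card.
Qed.

Lemma prob_le_add (P P1 P2 : pred {ffun V -> VH}) : (forall f, P f -> P1 f || P2 f) ->
  prob eG eH lam P <= prob eG eH lam P1 + prob eG eH lam P2.
Proof.
move=> H; rewrite /prob !big_mkcondr -big_split; apply: ler_sum => f _ /=.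
have p0 := pr_ge0 lam_gt0 Z_gt0 f.
by case: ifP => [/H|_]; case: (P1 f); case: (P2 f) => //= *; lra.
Qed.

End Deviation.

Theorem theorem1p6 (R : realType) (VH : finType) (eH : rel VH) (lam : VH -> R)
    (eH_sym : symmetric eH) (eH_edge : exists i j : VH, eH i j)
    (lam_gt0 : forall i : VH, 0 < lam i) :
  exists c1 c2 c3 c4 : R,
    [/\ 0 < c1, 0 < c2, 0 < c3 & 0 < c4] /\
    forall (VG : finType) (eG : rel VG) (E O : {set VG}) (d : R),
      symmetric eG -> irreflexive eG ->
      (0 < #|VG|)%N ->
      bipartition eG E O ->
      (#|E| <= #|O|)%N ->
      0 < d ->
      let N : R := #|VG|%:R in
      let h : R := hfun eG E O d in
      let zeta : R := Num.max (Num.sqrt h) (Num.sqrt (log2 N / N)) in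
      (forall (eps : R) (k : VH),
         c1 * Num.sqrt h <= eps ->
         prob eG eH lam (fun f => share R k f \in Iset eH lam k eps)
           <= c2 * eps^-1 * 2 `^ (- (c3 * eps ^+ 2 * N)))
      /\
      (forall k : VH,
         aminus eH lam k - c4 * zeta <= pbar eG eH lam k
           <= aplus eH lam k + c4 * zeta).
Proof.
have [c [C [c0 C1 mgfB]]] := mgf_bound eH_sym eH_edge lam_gt0.
have C0 : 0 < C by exact: lt_le_trans C1.
have ln2 : 0 < ln (2 : R) by rewrite ln_gt0 // ltr1n.
have cC0 : 0 < 8 * C * c by rewrite !mulr_gt0.
exists (Num.sqrt (8 * C * c)), 2, (8 * C * ln 2)^-1, (C + c + 2); split.
  by split; rewrite ?sqrtr_gt0 ?invr_gt0 ?mulr_gt0 ?addr_gt0.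
move=> VG eG E O d eG_sym _ V0 bip EO d0 N h zeta.
have N0 : 0 < N by rewrite ltr0n.
have h0 : 0 < h by exact: hfun_gt0.
have Z0 : 0 < Zfun eG eH lam.
  apply: lt_le_trans (Zfun_ge eH_sym eH_edge eG_sym bip EO lam_gt0).
  exact: expR_gt0.
have upper k t : `|t| <= 2^-1 -> 0 <= 1 * t -> mgf (eH := eH) lam eG k t <=
    expR (N * (t * aplus eH lam k + C * t ^+ 2 + c * h)).
  rewrite mul1r => t2 t0; apply: (mgfB VG eG E O d) => //.
    exact: occ_max_bounds.
  by move=> AB; exact: mul_occ_le_max.
have lower k t : `|t| <= 2^-1 -> 0 <= -1 * t -> mgf (eH := eH) lam eG k t <=
    expR (N * (t * aminus eH lam k + C * t ^+ 2 + c * h)).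
  rewrite mulN1r oppr_ge0 => t2 t0; apply: (mgfB VG eG E O d) => //.
    exact: occ_min_bounds.
  by move=> AB; exact: mul_occ_le_min.
split=> [eps k ceps|k]; last first.
  have [a0 a1] := andP (aplus_bounds eH_edge lam_gt0 k).
  have [b0 b1] := andP (aminus_bounds eH_edge lam_gt0 k).
  have [p0 p1] := andP (pbar_bounds lam_gt0 V0 Z0 k).
  have c4 : 0 < C + c + 2 by rewrite !addr_gt0.
  have zh : (C + c + 2) * Num.sqrt h <= (C + c + 2) * zeta.
    by rewrite ler_pM2l // le_max lexx.
  have s0 : 0 <= Num.sqrt h by exact: sqrtr_ge0.
  have [hs|hs] := lerP (Num.sqrt h) 2^-1.
    have := mean_bound lam_gt0 V0 Z0 h0 (k := k) (s := 1) _ hs (upper k).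
    have := mean_bound lam_gt0 V0 Z0 h0 (k := k) (s := -1) _ hs (lower k).
    rewrite !inE !eqxx orbT => /(_ isT) H1 /(_ isT) H2.
    apply/andP; split; lra.
  (* Here [c4 * zeta >= 1], so the interval contains every possible mean. *)
  have : 1 <= (C + c + 2) * Num.sqrt h.
    have : (C + c) * 2^-1 <= (C + c) * Num.sqrt h by rewrite ler_wpM2l ?addr_ge0 // ltW.
    have : 0 < C + c by rewrite addr_gt0.
    lra.
  by move=> H; apply/andP; split; lra.
have sh0 : 0 < Num.sqrt h by rewrite sqrtr_gt0.
have eps0 : 0 < eps by apply: lt_le_trans ceps; rewrite mulr_gt0 ?sqrtr_gt0.
have /andP[a0 a1] := aplus_bounds eH_edge lam_gt0 k.
have /andP[b0 b1] := aminus_bounds eH_edge lam_gt0 k.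
(* For [eps > 1] the set [Iset] contains no share, since [aplus] and [aminus] lie
   between 0 and 1. *)
have [eps1|eps1] := lerP eps 1; last first.
  rewrite /prob big_pred0 => [|f].
    by rewrite !mulr_ge0 ?powR_ge0 ?invr_ge0 ?ltW.
  apply/negP => /andP[_]; rewrite /Iset inE /= !in_itv /=.
  by move=> /orP[/andP[]|/andP[]]; lra.
have ch : c * h <= eps ^+ 2 / (8 * C).
  rewrite ler_pdivlMr ?mulr_gt0 //.
  have -> : c * h * (8 * C) = (Num.sqrt (8 * C * c) * Num.sqrt h) ^+ 2.
    by rewrite exprMn !sqr_sqrtr ?(ltW h0) ?(ltW cC0) //; ring.
  by rewrite lerXn2r ?nnegrE ?mulr_ge0 ?sqrtr_ge0 // ltW.
have e01 : 0 <= eps <= 1 by rewrite (ltW eps0).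
have shareE (f : {ffun VG -> VH}) : colour_count k f / N = share R k f by [].
pose P1 (f : {ffun VG -> VH}) := share R k f < aminus eH lam k - eps.
pose P2 (f : {ffun VG -> VH}) := aplus eH lam k + eps < share R k f.
have t1 : prob eG eH lam P1 <= expR (- (N * (eps ^+ 2 / (8 * C)))).
  apply: (tail_bound lam_gt0 V0 Z0 C1 _ e01 ch (lower k)); first by rewrite !inE eqxx orbT.
  by move=> f; rewrite /P1 shareE; lra.
have t2 : prob eG eH lam P2 <= expR (- (N * (eps ^+ 2 / (8 * C)))).
  apply: (tail_bound lam_gt0 V0 Z0 C1 _ e01 ch (upper k)); first by rewrite !inE eqxx.
  by move=> f; rewrite /P2 shareE; lra.
apply: (@le_trans _ _ (prob eG eH lam P1 + prob eG eH lam P2)).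
  apply: prob_le_add => // f; rewrite /Iset inE /= !in_itv /=.
  by rewrite /P1 /P2 => /orP[/andP[_ ->]|/andP[-> _]]; rewrite ?orbT.
have -> : 2 `^ (- ((8 * C * ln 2)^-1 * eps ^+ 2 * N)) = expR (- (N * (eps ^+ 2 / (8 * C)))).
  rewrite -[X in X `^ _](@lnK R 2) ?posrE // -expRM; congr expR.
  by field; rewrite !gt_eqF.
have e0 := expR_ge0 (- (N * (eps ^+ 2 / (8 * C)))).
(* The two tails give a factor 2, and [eps^-1] costs nothing as [eps <= 1]. *)
have einv : 1 <= eps^-1 by rewrite invf_ge1.
apply: (@le_trans _ _ (2 * 1 * expR (- (N * (eps ^+ 2 / (8 * C)))))); first lra.
by rewrite ler_wpM2r // ler_wpM2l.
Qed.
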